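(* Consider the Bass model on the homogeneous infinite line. Let $f(t)$, $y(t)$, $\Psi_1(t)$, and $\Psi_2(t)$ be the solutions of the boundary-value problem $$\frac{df}{dt}=\big(p(s_p(t))+q(s_q(t))(1-e^{-y})\big)(1-f),\qquad f(0)=0,$$ $$\frac{dy}{dt}=p(s_p(t)),\qquad y(0)=0,$$ $$\frac{d\Psi_1}{dt}=(\gamma e^{-\theta t}+\Psi_1)\big(p(s_p(t))+q(s_q(t))(1-e^{-y})\big),\qquad \Psi_1(T)=0,$$ $$\frac{d\Psi_2}{dt}=-(\gamma e^{-\theta t}+\Psi_1)(1-f)q(s_q(t))e^{-y},\qquad \Psi_2(T)=0.$$ Then the optimal promotion $\mathbf{s}^{\rm opt}:=(s_p^{\rm opt},s_q^{\rm opt})$, i.e. the maximizer of $\Pi[\mathbf{s}(t)]$ over $\mathcal{S}^2$, satisfies the condition $$\frac{\partial H}{\partial s_p}=\frac{\partial H}{\partial s_q}=0,\qquad H:=\Big(\gamma\frac{df}{dt}-s_p(t)-s_q(t)\Big)e^{-\theta t}+\Psi_1\frac{df}{dt}+\Psi_2\,p(s_p(t)),$$ where in $H$ the derivative $\frac{df}{dt}$ stands for the right-hand side of the first equation.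
   Context: Bass model on the homogeneous infinite line $\mathbb{Z}$ under the promotion $\mathbf{s}(t)=(s_p(t),s_q(t))$ (spending rates per consumer): all nodes are nonadopters at $t=0$; a nonadopter $j\in\mathbb{Z}$ adopts at rate $p(s_p(t))+\frac{q(s_q(t))}{2}\big(X_{j-1}(t)+X_{j+1}(t)\big)$, where $X_i(t)\in\{0,1\}$ is the adoption state of node $i$ ($1$ = adopter) and $p$, $q$ are the external and internal influence rates; adopters remain adopters. It is known that the expected adoption level $f(t)$ is the solution of $\frac{df}{dt}=\big(p+q(1-e^{-\int_0^t p})\big)(1-f)$, $f(0)=0$, with $p=p(s_p(t))$, $q=q(s_q(t))$. $T$ is the planning horizon, $\mathcal{S}$ is the set of piecewise-continuous functions from $[0,T]$ to the nonnegative reals, $\theta$ is the discount rate, $\gamma$ is the income generated by the sale of one unit of the product, and the profit is $\Pi[\mathbf{s}(t)]=\int_0^T e^{-\theta t}\big(\gamma\frac{df}{dt}-(s_p(t)+s_q(t))\big)dt$.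
   Formalization: Each condition ∂H/∂s_p=0, ∂H/∂s_q=0 is proved at times where that component of the optimal promotion is positive and continuous; it can fail at zero spending (p, q constant: optimum s=0, ∂H/∂s_p=-e^{-θt}) and at jump points. *)

(* Defs.v *)
From Stdlib Require Export Reals List.
From Coquelicot Require Export Coquelicot.
Open Scope R_scope.

(* Differentiability is asked only for positive spending, so that rates with
   infinite marginal effect at zero, such as [sqrt], are allowed. *)
Definition influence_rate (r : R -> R) : Prop :=
  (forall s, 0 <= s -> 0 <= r s) /\
  continuous_on (fun s => 0 <= s) r /\
  (forall s, 0 < s -> ex_derive r s).

Definition continuous_at_in (T : R) (g : R -> R) (t : R) : Prop :=
  filterlim g (within (fun u => 0 <= u <= T) (locally t)) (locally (g t)).

(* Finitely many jumps, with finite one-sided limits; the value at a jump (or at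
   an end point) is unconstrained. *)
Definition piecewise_continuous (T : R) (g : R -> R) : Prop :=
  (exists l : list R, forall t, 0 < t < T -> ~ In t l -> continuous g t) /\
  (forall t, 0 <= t < T -> exists r : R, filterlim g (at_right t) (locally r)) /\
  (forall t, 0 < t <= T -> exists r : R, filterlim g (at_left t) (locally r)).

Definition spending_rate (T : R) (s : R -> R) : Prop :=
  piecewise_continuous T s /\ (forall t, 0 <= t <= T -> 0 <= s t).

(* Right-hand sides are only piecewise continuous in time, so a solution is a
   continuous function on [0,T] satisfying the equation at all but finitely many
   times. *)
Definition solves_ode (T : R) (x rhs : R -> R) : Prop :=
  continuous_on (fun t => 0 <= t <= T) x /\
  exists l : list R, forall t, 0 < t < T -> ~ In t l -> is_derive x t (rhs t).

(* The expected adoption level on the infinite line, through its known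
   characterization by an ordinary differential equation. *)
Definition adoption_level (p q : R -> R) (T : R) (sp sq f : R -> R) : Prop :=
  solves_ode T f
    (fun t => (p (sp t) + q (sq t) * (1 - exp (- RInt (fun u => p (sp u)) 0 t)))
              * (1 - f t)) /\
  f 0 = 0.

Definition is_profit (p q : R -> R) (T theta gamma : R) (sp sq : R -> R) (P : R)
  : Prop :=
  exists f, adoption_level p q T sp sq f /\
    is_RInt (fun t => exp (- theta * t) * (gamma * Derive f t - (sp t + sq t)))
      0 T P.

Definition optimal_promotion (p q : R -> R) (T theta gamma : R)
    (sp sq : R -> R) : Prop :=
  spending_rate T sp /\ spending_rate T sq /\
  exists P, is_profit p q T theta gamma sp sq P /\
    forall sp' sq' P', spending_rate T sp' -> spending_rate T sq' ->
      is_profit p q T theta gamma sp' sq' P' -> P' <= P.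

Definition df_dt (p q : R -> R) (f y a b : R) : R :=
  (p a + q b * (1 - exp (- y))) * (1 - f).

(* [a] and [b] are the values of the controls s_p and s_q. *)
Definition hamiltonian (p q : R -> R) (theta gamma t f y psi1 psi2 a b : R) : R :=
  (gamma * df_dt p q f y a b - a - b) * exp (- theta * t)
  + psi1 * df_dt p q f y a b + psi2 * p a.

(* Main.v *)
(* Needle variation. Replacing the promotion on a short interval of length [h] by
   another one changes the state by O(h). The costates [psi1], [psi2] are chosen so
   that the first-order effect of this change on the profit integrates to zero: the
   derivative of (accumulated profit gain) + psi1 * (change of f) + psi2 * (change of y)
   is the change of the Hamiltonian on the needle, up to O(h) on the needle and
   O(h^2) outside. Optimality hence makes the control value at [t] a maximizer of the
   Hamiltonian, and an interior maximum is a critical point. Since [p] and [q] need not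
   be C^1, a uniformly small variation would not do. *)
Require Import Defs.
From Stdlib Require Import Lra Psatz.
Open Scope R_scope.

(** The adoption equation is linear in [1 - f], and its coefficient, the hazard, does not involve
    [f]. Hence [1 - f] is the exponential of minus the cumulative hazard, every profit is an
    explicit integral, and the change of state caused by a needle is bounded by integrating rates,
    without a Gronwall argument. Promotions may jump, so states, costates and accumulated profits
    are differentiable only off a finite set. Every estimate is therefore a mean value inequality
    that tolerates finitely many exceptional times, with one rate on the needle and another off it.
    In the variables [u = 1 - f] and [v = exp (- y)], which stay in [0,1], the gap between the
    derivative of the augmented profit gain and the change of the Hamiltonian is an exact algebraic
    remainder. Its terms are products of two small quantities, or contain the quadratic Taylor error
    of [exp (- y)]. In the end one control at a time is varied, to a constant level. This yields the
    two partial derivatives separately and asks for continuity of the varied control only. *)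

(** * Properties that hold off finitely many points *)

Definition almost (a b : R) (P : R -> Prop) : Prop :=
  exists l : list R, forall t, a < t < b -> ~ In t l -> P t.

Lemma almost_and (a b : R) (P Q : R -> Prop) :
  almost a b P -> almost a b Q -> almost a b (fun t => P t /\ Q t).
Proof.
  intros [l1 H1] [l2 H2]; exists (l1 ++ l2)%list; intros t Ht Hl.
  split; [apply H1 | apply H2]; auto; intros Hi; apply Hl, in_or_app; auto.
Qed.

Lemma almost_imp (a b : R) (P Q : R -> Prop) :
  almost a b P -> (forall t, a < t < b -> P t -> Q t) -> almost a b Q.
Proof. intros [l H] PQ; exists l; auto. Qed.

Lemma almost_sub (a b c d : R) (P : R -> Prop) :
  a <= c -> d <= b -> almost a b P -> almost c d P.
Proof. intros ac db [l H]; exists l; intros t Ht; apply H; lra. Qed.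

Lemma almost_neq (a b c : R) : almost a b (fun t => t <> c).
Proof. exists (c :: nil); intros t _ Hl E; apply Hl; left; auto. Qed.

(** An exceptional point inside the interval cuts it in two, and one outside is dropped. A statement
    that survives concatenation of intervals thus needs a proof only in the absence of
    exceptions. *)
Lemma almost_split_ind (P : R -> Prop) (Q : R -> R -> Prop) :
  (forall a b, a < b -> (forall t, a < t < b -> P t) -> Q a b) ->
  (forall a c b, a < c < b -> Q a c -> Q c b -> Q a b) ->
  forall a b, a < b -> almost a b P -> Q a b.
Proof.
  intros H0 Hs a b ab [l Hl]; revert a b ab Hl.
  induction l as [|c l IH]; intros a b ab Hl.
  - apply H0; auto.
  - destruct (Rlt_dec a c) as [ac|ac]; [destruct (Rlt_dec c b) as [cb|cb]|].
    + apply (Hs a c b); [lra| |]; apply IH; try lra;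
        intros t Ht Hi; (apply Hl; [lra|intros [E|Hi2]; [lra|auto]]).
    + apply IH; auto; intros t Ht Hi; (apply Hl; [lra|intros [E|Hi2]; [lra|auto]]).
    + apply IH; auto; intros t Ht Hi; (apply Hl; [lra|intros [E|Hi2]; [lra|auto]]).
Qed.

(** * Mean value inequalities with exceptional times *)

Lemma continuous_on_at (D : R -> Prop) (g : R -> R) (t : R) :
  continuous_on D g -> locally t D -> continuous g t.
Proof. intros Hg Ht; exact (continuous_continuous_on D g t Ht Hg). Qed.

Lemma locally_interior (a b t : R) : a < t < b -> locally t (fun u => a <= u <= b).
Proof.
  intros Ht; apply (locally_interval _ t a b); simpl; try lra; intros; lra.
Qed.

Lemma continuous_on_subinterval (a b c d : R) (g : R -> R) :
  a <= c -> d <= b -> continuous_on (fun t => a <= t <= b) g ->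
  continuous_on (fun t => c <= t <= d) g.
Proof. intros ac db; apply continuous_on_subset; simpl; intros t Ht; lra. Qed.

(* [MVT_gen] wants two-sided continuity at the end points, hence the clamping. *)
Lemma derive_ge_slope_smooth (a b m : R) (g dg : R -> R) :
  a < b -> continuous_on (fun t => a <= t <= b) g ->
  (forall t, a < t < b -> is_derive g t (dg t) /\ m <= dg t) ->
  m * (b - a) <= g b - g a.
Proof.
  intros ab Hc Hd.
  set (k := fun t => Rmax a (Rmin t b)).
  assert (Ek : forall t, a <= t <= b -> k t = t).
  { intros t Ht; unfold k; rewrite Rmin_left, Rmax_right; lra. }
  assert (Kin : forall t, a <= k t <= b).
  { intros t; unfold k, Rmax, Rmin; destruct (Rle_dec t b); destruct (Rle_dec a _); lra. }
  (* The intermediate point may be an end point, where [dg] is not controlled; [Rmax m] keeps the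
     slope at least [m] there too. *)
  destruct (MVT_gen (fun t => g (k t)) a b
              (fun t => Rmax m (dg t))) as [c [_ Hc']].
  - rewrite Rmin_left, Rmax_right by lra; intros t Ht.
    rewrite Rmax_right by apply (Hd t Ht).
    apply is_derive_ext_loc with g; [|apply Hd; auto].
    apply (locally_interval _ t a b); simpl; try lra.
    intros u ? ?; rewrite Ek; [auto|lra].
  - rewrite Rmin_left, Rmax_right by lra; intros t Ht.
    apply continuity_pt_filterlim.
    apply filterlim_comp with (within (fun u => a <= u <= b) (locally (k t))).
    + intros P HP. unfold filtermap.
      assert (K : filterlim k (locally t) (locally (k t))).
      { intros P' [e He]; exists e; intros u Hu; apply He; revert Hu.
        unfold ball; simpl; unfold AbsRing_ball, abs, minus, plus, opp; simpl.
        unfold k, Rmax, Rmin; repeat destruct Rle_dec;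
          unfold Rabs; repeat destruct Rcase_abs; lra. }
      assert (K' := K _ HP); unfold filtermap in K'.
      apply filter_imp with (2 := K'); intros u Hu; apply Hu, Kin.
    + apply Hc, Kin.
  - rewrite !Ek in Hc' by lra; rewrite Hc'.
    apply Rmult_le_compat_r; [lra|apply Rmax_l].
Qed.

(** Increments over adjacent pieces add up because [g] is continuous across the exceptional
    times. *)
Lemma derive_ge_slope (a b m : R) (g dg : R -> R) :
  a <= b -> continuous_on (fun t => a <= t <= b) g ->
  almost a b (fun t => is_derive g t (dg t) /\ m <= dg t) ->
  m * (b - a) <= g b - g a.
Proof.
  intros [ab|<-] Hc Ha; [|lra]; revert Hc.
  apply (almost_split_ind (fun t => is_derive g t (dg t) /\ m <= dg t)
    (fun a b => continuous_on (fun t => a <= t <= b) g -> m * (b - a) <= g b - g a));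
    auto.
  - intros; apply derive_ge_slope_smooth with dg; auto.
  - intros a' c b' H H1 H2 Hc.
    assert (H3 := H1 (continuous_on_subinterval a' b' a' c _ ltac:(lra) ltac:(lra) Hc)).
    assert (H4 := H2 (continuous_on_subinterval a' b' c b' _ ltac:(lra) ltac:(lra) Hc)).
    lra.
Qed.

Lemma derive_zero_constant (T : R) (g : R -> R) :
  solves_ode T g (fun _ => 0) -> forall t, 0 <= t <= T -> g t = g 0.
Proof.
  intros [Hc Hd] t Ht.
  assert (Hct := continuous_on_subinterval 0 T 0 t _ ltac:(lra) ltac:(lra) Hc).
  assert (Hdt := almost_sub 0 T 0 t _ ltac:(lra) ltac:(lra) Hd).
  assert (H1 := derive_ge_slope 0 t 0 g (fun _ => 0) ltac:(lra) Hct
    ltac:(apply almost_imp with (1 := Hdt); intros; split; [auto|lra])).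
  assert (H2 := derive_ge_slope 0 t 0 (fun u => - g u) (fun _ => 0) ltac:(lra)).
  simpl in H2; enough (0 * (t - 0) <= - g t - - g 0) by lra.
  apply H2.
  - intros u Hu; apply (filterlim_comp _ _ _ g Ropp _ (locally (g u))); [apply Hct; auto|].
    apply (filterlim_opp (g u)).
  - apply almost_imp with (1 := Hdt); intros u _ Hu; split; [|lra].
    evar_last; [apply (is_derive_opp g u 0 Hu)|apply Ropp_0].
Qed.

(** * Growth bounds with a different rate on the needle *)

Definition needle_indicator (t0 t1 t : R) : R :=
  if Rlt_dec t0 t then if Rlt_dec t t1 then 1 else 0 else 0.

(** The interval [0,t] is cut at [Rmin t t0] and [Rmin t t1]. Clipping at [t] covers every position
    of [t] at once: [Rmin t t1 - Rmin t t0] is the length of the part of the needle already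
    passed. *)
Lemma needle_growth_ge (T t0 t1 A B t : R) (g dg : R -> R) :
  0 <= t0 < t1 -> t1 <= T -> 0 <= t <= T ->
  continuous_on (fun t => 0 <= t <= T) g ->
  almost 0 T (fun t => is_derive g t (dg t) /\
                       A + B * needle_indicator t0 t1 t <= dg t) ->
  A * t + B * (Rmin t t1 - Rmin t t0) <= g t - g 0.
Proof.
  intros H01 HT Ht Hc Hd.
  assert (P : forall a b m, 0 <= a <= b -> b <= T ->
     (forall u, a < u < b -> m = A + B * needle_indicator t0 t1 u) ->
     m * (b - a) <= g b - g a).
  { intros a b m ab bT Hm; apply derive_ge_slope with dg; [lra| |].
    - apply continuous_on_subinterval with (3 := Hc); lra.
    - apply almost_imp with (P := fun t => is_derive g t (dg t) /\
                       A + B * needle_indicator t0 t1 t <= dg t).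
      + apply almost_sub with (3 := Hd); lra.
      + intros u Hu [H1 H2]; split; auto; rewrite (Hm u Hu); auto. }
  assert (M : 0 <= Rmin t t0 <= Rmin t t1 /\ Rmin t t1 <= t).
  { unfold Rmin; repeat destruct Rle_dec; lra. }
  assert (P1 := P 0 (Rmin t t0) A ltac:(lra) ltac:(lra)).
  assert (P2 := P (Rmin t t0) (Rmin t t1) (A + B) ltac:(lra) ltac:(lra)).
  assert (P3 := P (Rmin t t1) t A ltac:(lra) ltac:(lra)).
  unfold needle_indicator in *.
  enough (A * (Rmin t t0 - 0) <= g (Rmin t t0) - g 0 /\
    (A + B) * (Rmin t t1 - Rmin t t0) <= g (Rmin t t1) - g (Rmin t t0) /\
    A * (t - Rmin t t1) <= g t - g (Rmin t t1)) by lra.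
  split; [|split]; [apply P1|apply P2|apply P3]; intros u Hu;
   revert Hu; unfold Rmin; repeat destruct Rle_dec; repeat destruct Rlt_dec; lra.
Qed.

(** Meant for [A] of the order of the needle length and [B] of order one, so that both terms of the
    bound are of the order of the needle length. *)
Lemma needle_growth_abs (T t0 t1 A B t : R) (g dg : R -> R) :
  0 <= t0 < t1 -> t1 <= T -> 0 <= t <= T -> 0 <= A -> 0 <= B ->
  continuous_on (fun t => 0 <= t <= T) g -> g 0 = 0 ->
  almost 0 T (fun t => is_derive g t (dg t) /\
                       Rabs (dg t) <= A + B * needle_indicator t0 t1 t) ->
  Rabs (g t) <= A * T + B * (t1 - t0).
Proof.
  intros H01 HT Ht HA HB Hc Hg0 Hd.
  assert (M : 0 <= Rmin t t1 - Rmin t t0 <= t1 - t0).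
  { unfold Rmin; repeat destruct Rle_dec; lra. }
  assert (H1 := needle_growth_ge T t0 t1 (- A) (- B) t g dg H01 HT Ht Hc).
  assert (H2 := needle_growth_ge T t0 t1 (- A) (- B) t (fun u => - g u) (fun u => - dg u) H01 HT Ht).
  assert (K1 : - A * t + - B * (Rmin t t1 - Rmin t t0) <= g t - g 0).
  { apply H1, almost_imp with (1 := Hd); intros u _ [Hu1 Hu2]; split; auto.
    apply Rabs_le_between in Hu2; lra. }
  assert (K2 : - A * t + - B * (Rmin t t1 - Rmin t t0) <= - g t - - g 0).
  { apply H2.
    - intros u Hu; apply (filterlim_comp _ _ _ g Ropp _ (locally (g u))); [apply Hc; auto|].
      apply (filterlim_opp (g u)).
    - apply almost_imp with (1 := Hd); intros u _ [Hu1 Hu2]; split.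
      + apply (is_derive_opp g u _ Hu1).
      + apply Rabs_le_between in Hu2; lra. }
  assert (A * t <= A * T) by (apply Rmult_le_compat_l; lra).
  assert (B * (Rmin t t1 - Rmin t t0) <= B * (t1 - t0)) by (apply Rmult_le_compat_l; lra).
  apply Rabs_le; lra.
Qed.

(** * Integrals and primitives of piecewise continuous functions *)

Lemma is_RInt_ext_almost (a b I : R) (g1 g2 : R -> R) :
  a < b -> almost a b (fun t => g1 t = g2 t) ->
  is_RInt g1 a b I -> is_RInt g2 a b I.
Proof.
  intros ab Ha; revert I.
  apply (almost_split_ind (fun t => g1 t = g2 t)
    (fun a b => forall I : R, is_RInt g1 a b I -> is_RInt g2 a b I)); auto.
  - clear; intros a b ab H I; apply is_RInt_ext.
    rewrite Rmin_left, Rmax_right by lra; auto.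
  - clear; intros a c b H H1 H2 I HI.
    assert (E : ex_RInt g1 a b) by (exists I; auto).
    destruct (ex_RInt_Chasles_1 g1 a c b ltac:(lra) E) as [I1 E1].
    destruct (ex_RInt_Chasles_2 g1 a c b ltac:(lra) E) as [I2 E2].
    replace I with (plus I1 I2).
    + apply is_RInt_Chasles with c; auto.
    + assert (U := is_RInt_Chasles _ _ _ _ _ _ E1 E2).
      rewrite <- (is_RInt_unique _ _ _ _ U); apply is_RInt_unique; auto.
Qed.

(** Between two exceptional points the one-sided limits extend [g] continuously to the closed piece,
    and the integral ignores the values at its ends. *)
Lemma piecewise_continuous_ex_RInt (T : R) (g : R -> R) :
  0 < T -> piecewise_continuous T g -> ex_RInt g 0 T.
Proof.
  intros HT [Hl [Hr Hf]]; revert Hr Hf.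
  apply (almost_split_ind (fun t => continuous g t) (fun a b =>
   (forall t, a <= t < b -> exists r : R, filterlim g (at_right t) (locally r)) ->
   (forall t, a < t <= b -> exists r : R, filterlim g (at_left t) (locally r)) ->
   ex_RInt g a b)); auto.
  - clear; intros a b ab H Hr Hl.
    destruct (Hr a ltac:(lra)) as [la Ha], (Hl b ltac:(lra)) as [lb Hb].
    destruct (C0_extension_lt g la lb a b ab H Ha Hb) as [k [K1 [K2 _]]].
    apply ex_RInt_ext with k.
    + rewrite Rmin_left, Rmax_right by lra; auto.
    + apply (ex_RInt_continuous (V := R_CompleteNormedModule)); intros; apply K1.
  - clear; intros a c b H H1 H2 Hr Hl.
    apply ex_RInt_Chasles with c; [apply H1|apply H2];
      intros; ((apply Hr; lra) || (apply Hl; lra)).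
Qed.

Lemma piecewise_continuous_bounded (T : R) (g : R -> R) :
  0 < T -> piecewise_continuous T g ->
  exists M, forall t, 0 <= t <= T -> Rabs (g t) <= M.
Proof.
  intros HT Hg; destruct (ex_RInt_ub g 0 T (piecewise_continuous_ex_RInt T g HT Hg)) as [M HM].
  exists M; intros t Ht; apply HM; rewrite Rmin_left, Rmax_right by lra; auto.
Qed.

Lemma lipschitz_continuous_on (T M : R) (g : R -> R) :
  (forall s t, 0 <= s <= T -> 0 <= t <= T -> Rabs (g s - g t) <= M * Rabs (s - t)) ->
  continuous_on (fun t => 0 <= t <= T) g.
Proof.
  intros H t Ht P [e He].
  assert (Hm : 0 < Rabs M + 1) by (generalize (Rabs_pos M); lra).
  exists (mkposreal (e / (Rabs M + 1)) (Rdiv_lt_0_compat _ _ (cond_pos e) Hm)).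
  intros u Hu Hu'; apply He; unfold ball in *; simpl in *.
  unfold AbsRing_ball, abs, minus, plus, opp in *; simpl in *.
  apply Rle_lt_trans with (1 := H u t Hu' Ht).
  apply Rle_lt_trans with ((Rabs M + 1) * Rabs (u - t)).
  - apply Rmult_le_compat_r; [apply Rabs_pos|generalize (Rle_abs M); lra].
  - apply Rmult_lt_compat_l with (1 := Hm) in Hu; unfold Rminus.
    replace ((Rabs M + 1) * (e / (Rabs M + 1))) with (pos e) in Hu by (field; lra).
    auto.
Qed.

(** Boundedness of [g] makes the primitive Lipschitz, hence continuous up to the ends and across
    jumps; the derivative exists wherever [g] is continuous. *)
Lemma primitive_solves_ode (T : R) (g : R -> R) :
  0 < T -> piecewise_continuous T g -> solves_ode T (fun t => RInt g 0 t) g.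
Proof.
  intros HT Hg.
  assert (Hi := piecewise_continuous_ex_RInt T g HT Hg).
  destruct (piecewise_continuous_bounded T g HT Hg) as [M HM].
  assert (Hab : forall a b, 0 <= a <= b -> b <= T -> ex_RInt g a b).
  { intros a b H1 H2; apply (ex_RInt_Chasles_2 g 0 a b); [lra|].
    apply (ex_RInt_Chasles_1 g 0 b T); [lra|auto]. }
  split.
  - apply lipschitz_continuous_on with M.
    assert (K : forall s t, 0 <= s <= t -> t <= T -> Rabs (RInt g 0 t - RInt g 0 s) <= M * Rabs (t - s)).
    { intros s t H1 H2.
      rewrite <- (RInt_Chasles g 0 s t) by (apply Hab; lra).
      change (plus (RInt g 0 s) (RInt g s t)) with (RInt g 0 s + RInt g s t).
      rewrite Rplus_minus_l.
      rewrite (Rabs_pos_eq (t - s)) by lra; rewrite Rmult_comm.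
      apply abs_RInt_le_const; [lra|apply Hab; lra|intros; apply HM; lra]. }
    intros s t Hs Ht; destruct (Rle_dec s t).
    + rewrite (Rabs_minus_sym s t), Rabs_minus_sym; apply K; lra.
    + apply K; lra.
  - destruct Hg as [[l Hl] _]; exists l; intros t Ht Hn.
    apply is_derive_RInt with 0; [|apply Hl; auto].
    apply filter_imp with (fun u => 0 <= u <= T); [|apply locally_interior; auto].
    intros u Hu; apply (RInt_correct (V := R_CompleteNormedModule)), Hab; lra.
Qed.

(** * Closure properties of piecewise continuity *)

Lemma piecewise_continuous_op2 (T : R) (h : R -> R -> R) (g1 g2 : R -> R) :
  (forall x y, filterlim (fun z : R * R => h (fst z) (snd z))
     (filter_prod (locally x) (locally y)) (locally (h x y))) ->
  piecewise_continuous T g1 -> piecewise_continuous T g2 ->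
  piecewise_continuous T (fun t => h (g1 t) (g2 t)).
Proof.
  intros Hh [C1 [R1 L1]] [C2 [R2 L2]]; split; [|split].
  - apply (almost_imp 0 T _ _ (almost_and 0 T _ _ C1 C2)).
    intros t _ [H1 H2]; eapply filterlim_comp_2; [apply H1|apply H2|apply Hh].
  - intros t Ht; destruct (R1 t Ht) as [r1 H1], (R2 t Ht) as [r2 H2].
    exists (h r1 r2); eapply filterlim_comp_2; [apply H1|apply H2|apply Hh].
  - intros t Ht; destruct (L1 t Ht) as [r1 H1], (L2 t Ht) as [r2 H2].
    exists (h r1 r2); eapply filterlim_comp_2; [apply H1|apply H2|apply Hh].
Qed.

Lemma piecewise_continuous_plus (T : R) (g1 g2 : R -> R) :
  piecewise_continuous T g1 -> piecewise_continuous T g2 ->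
  piecewise_continuous T (fun t => g1 t + g2 t).
Proof.
  apply (piecewise_continuous_op2 T Rplus); intros x y; apply (filterlim_plus x y).
Qed.

Lemma piecewise_continuous_mult (T : R) (g1 g2 : R -> R) :
  piecewise_continuous T g1 -> piecewise_continuous T g2 ->
  piecewise_continuous T (fun t => g1 t * g2 t).
Proof.
  apply (piecewise_continuous_op2 T Rmult); intros x y; apply (filterlim_mult x y).
Qed.

Lemma piecewise_continuous_minus (T : R) (g1 g2 : R -> R) :
  piecewise_continuous T g1 -> piecewise_continuous T g2 ->
  piecewise_continuous T (fun t => g1 t - g2 t).
Proof.
  apply (piecewise_continuous_op2 T Rminus); intros x y.
  apply (filterlim_comp_2 (G := locally x) (H := locally (- y)) fst (fun z => - snd z) Rplus);
    [apply filterlim_fst| |apply (filterlim_plus x (- y))].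
  eapply filterlim_comp; [apply filterlim_snd|apply (filterlim_opp y)].
Qed.

Lemma within_sub (D E : R -> Prop) (F : (R -> Prop) -> Prop) {FF : Filter F} :
  F (fun u => D u -> E u) -> filter_le (within D F) (within E F).
Proof.
  intros HDE P HP; unfold within in *.
  generalize (filter_and _ _ HDE HP); apply filter_imp; intros u [H1 H2] Hu; auto.
Qed.

Lemma continuous_on_piecewise_continuous (T : R) (g : R -> R) :
  continuous_on (fun t => 0 <= t <= T) g -> piecewise_continuous T g.
Proof.
  intros Hg; split; [|split].
  - exists nil; intros t Ht _; apply (continuous_on_at _ _ _ Hg), locally_interior; auto.
  - intros t Ht; exists (g t); eapply filterlim_filter_le_1; [|apply Hg; lra].
    apply within_sub; [apply locally_filter|].
    apply (locally_interval _ t m_infty T); simpl; try lra; auto; intros; lra.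
  - intros t Ht; exists (g t); eapply filterlim_filter_le_1; [|apply Hg; lra].
    apply within_sub; [apply locally_filter|].
    apply (locally_interval _ t 0 p_infty); simpl; try lra; auto; intros; lra.
Qed.

Lemma filterlim_rate_comp (r s : R -> R) (x : R) (F : (R -> Prop) -> Prop) {FF : Filter F} :
  influence_rate r -> 0 <= x -> F (fun u => 0 <= s u) ->
  filterlim s F (locally x) -> filterlim (fun u => r (s u)) F (locally (r x)).
Proof.
  intros [_ [Hr _]] Hx H0 Hs.
  apply filterlim_comp with (within (fun s => 0 <= s) (locally x)); [|apply Hr; auto].
  intros P HP; generalize (filter_and _ _ H0 (Hs _ HP)); apply filter_imp.
  intros u [H1 H2]; auto.
Qed.

Lemma filterlim_nonneg (s : R -> R) (x : R) (F : (R -> Prop) -> Prop) {FF : ProperFilter F} :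
  F (fun u => 0 <= s u) -> filterlim s F (locally x) -> 0 <= x.
Proof.
  intros H0 Hs.
  apply (filterlim_le (F := F) (fun _ => 0) s 0 x); auto.
  apply filterlim_const.
Qed.

(** One-sided limits of a nonnegative promotion are nonnegative, so they stay in the half-line on
    which the rate is assumed continuous. *)
Lemma spending_rate_influence (T : R) (r s : R -> R) :
  influence_rate r -> spending_rate T s -> piecewise_continuous T (fun t => r (s t)).
Proof.
  intros Hr [[C [Cr Cl]] H0]; split; [|split].
  - apply (almost_imp 0 T _ _ C); intros t Ht Hs.
    apply (filterlim_rate_comp r s (s t) (locally t)); auto; [apply H0; lra|].
    apply filter_imp with (2 := locally_interior _ _ _ Ht); auto.
  - intros t Ht; destruct (Cr t Ht) as [x Hx]; exists (r x).
    assert (P : at_right t (fun u => 0 <= s u)).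
    { apply (locally_interval _ t m_infty T); simpl; try lra; auto; intros; apply H0; lra. }
    apply filterlim_rate_comp; auto; [apply within_filter, locally_filter|].
    apply (filterlim_nonneg s x (at_right t)); auto.
  - intros t Ht; destruct (Cl t Ht) as [x Hx]; exists (r x).
    assert (P : at_left t (fun u => 0 <= s u)).
    { apply (locally_interval _ t 0 p_infty); simpl; try lra; auto; intros; apply H0; lra. }
    apply filterlim_rate_comp; auto; [apply within_filter, locally_filter|].
    apply (filterlim_nonneg s x (at_left t)); auto.
Qed.

(* [auto_derive] leaves derivatives in eta-expanded form. *)
Lemma Derive_eta (g : R -> R) (t l : R) :
  is_derive g t l -> Derive (fun x : R => g x) t = l.
Proof. exact (is_derive_unique g t l). Qed.

(** * Continuity on a set: composition and arithmetic *)

Lemma continuous_on_comp (D : R -> Prop) (h g : R -> R) :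
  (forall x, continuous h x) -> continuous_on D g -> continuous_on D (fun t => h (g t)).
Proof. intros Hh Hg t Ht; eapply filterlim_comp; [apply Hg; auto|apply Hh]. Qed.

Lemma filterlim_Rplus (F : (R -> Prop) -> Prop) {FF : Filter F} (g1 g2 : R -> R) (x1 x2 : R) :
  filterlim g1 F (locally x1) -> filterlim g2 F (locally x2) ->
  filterlim (fun t => g1 t + g2 t) F (locally (x1 + x2)).
Proof. intros H1 H2; exact (filterlim_comp_2 _ _ _ H1 H2 (filterlim_plus x1 x2)). Qed.

Lemma filterlim_Rmult (F : (R -> Prop) -> Prop) {FF : Filter F} (g1 g2 : R -> R) (x1 x2 : R) :
  filterlim g1 F (locally x1) -> filterlim g2 F (locally x2) ->
  filterlim (fun t => g1 t * g2 t) F (locally (x1 * x2)).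
Proof. intros H1 H2; exact (filterlim_comp_2 _ _ _ H1 H2 (filterlim_mult x1 x2)). Qed.

Lemma filterlim_Rminus (F : (R -> Prop) -> Prop) {FF : Filter F} (g1 g2 : R -> R) (x1 x2 : R) :
  filterlim g1 F (locally x1) -> filterlim g2 F (locally x2) ->
  filterlim (fun t => g1 t - g2 t) F (locally (x1 - x2)).
Proof.
  intros H1 H2; apply (filterlim_Rplus F g1 (fun t => - g2 t) x1 (- x2)); auto.
  apply filterlim_comp with (1 := H2), (filterlim_opp x2).
Qed.

Lemma continuous_on_plus (D : R -> Prop) (g1 g2 : R -> R) :
  continuous_on D g1 -> continuous_on D g2 -> continuous_on D (fun t => g1 t + g2 t).
Proof.
  intros H1 H2 t Ht; apply filterlim_Rplus; [apply within_filter, locally_filter|auto|auto].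
Qed.

Lemma continuous_on_mult (D : R -> Prop) (g1 g2 : R -> R) :
  continuous_on D g1 -> continuous_on D g2 -> continuous_on D (fun t => g1 t * g2 t).
Proof.
  intros H1 H2 t Ht; apply filterlim_Rmult; [apply within_filter, locally_filter|auto|auto].
Qed.

Lemma continuous_on_minus (D : R -> Prop) (g1 g2 : R -> R) :
  continuous_on D g1 -> continuous_on D g2 -> continuous_on D (fun t => g1 t - g2 t).
Proof.
  intros H1 H2 t Ht; apply filterlim_Rminus; [apply within_filter, locally_filter|auto|auto].
Qed.

Lemma continuous_on_const (D : R -> Prop) (c : R) :
  continuous_on D (fun _ : R => c : R_UniformSpace).
Proof. intros t _; apply filterlim_const. Qed.

Lemma continuous_on_exp_scal (D : R -> Prop) (c : R) : continuous_on D (fun t => exp (c * t)).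
Proof.
  apply continuous_on_forall; intros x _.
  apply (ex_derive_continuous (fun t => exp (c * t))); auto_derive; auto.
Qed.

Lemma continuous_on_one_minus_exp_opp (D : R -> Prop) (g : R -> R) :
  continuous_on D g -> continuous_on D (fun t => 1 - exp (- g t)).
Proof.
  apply (continuous_on_comp D (fun x => 1 - exp (- x))); intros x.
  apply (ex_derive_continuous (fun x => 1 - exp (- x))); auto_derive; auto.
Qed.

(** * Uniqueness for quadratures and sign of primitives *)

Lemma solves_ode_ext (T : R) (x rhs1 rhs2 : R -> R) :
  (forall t, 0 < t < T -> rhs1 t = rhs2 t) -> solves_ode T x rhs1 -> solves_ode T x rhs2.
Proof.
  intros E [Hc Hd]; split; auto.
  apply (almost_imp 0 T _ _ Hd); intros t Ht H; rewrite <- E; auto.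
Qed.

Lemma solves_ode_quadrature_unique (T : R) (x1 x2 g : R -> R) :
  solves_ode T x1 g -> solves_ode T x2 g -> x1 0 = x2 0 ->
  forall t, 0 <= t <= T -> x1 t = x2 t.
Proof.
  intros [C1 D1] [C2 D2] E t Ht.
  enough (x1 t - x2 t = x1 0 - x2 0) by lra.
  apply (derive_zero_constant T (fun t => x1 t - x2 t)); auto; split.
  - apply continuous_on_minus; auto.
  - apply (almost_imp 0 T _ _ (almost_and 0 T _ _ D1 D2)); intros u _ [H1 H2].
    evar_last; [apply (is_derive_minus x1 x2 u _ _ H1 H2)|apply Rminus_diag_eq; auto].
Qed.

Lemma primitive_nonneg (T : R) (g : R -> R) :
  0 < T -> piecewise_continuous T g -> (forall t, 0 <= t <= T -> 0 <= g t) ->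
  forall t, 0 <= t <= T -> 0 <= RInt g 0 t.
Proof.
  intros HT Hg H0 t Ht; apply RInt_ge_0; [lra| |intros; apply H0; lra].
  apply (ex_RInt_Chasles_1 g 0 t T); [lra|apply piecewise_continuous_ex_RInt; auto].
Qed.

(** * The adoption level in closed form and the profit as an integral *)

Definition cum_external (p sp : R -> R) (t : R) : R := RInt (fun u => p (sp u)) 0 t.

Definition hazard (p q sp sq : R -> R) (t : R) : R :=
  p (sp t) + q (sq t) * (1 - exp (- cum_external p sp t)).

Definition cum_hazard (p q sp sq : R -> R) (t : R) : R := RInt (hazard p q sp sq) 0 t.

Definition adoption (p q sp sq : R -> R) (t : R) : R := 1 - exp (- cum_hazard p q sp sq t).

(** The profit integrand with [Derive f] replaced by the right-hand side of its equation, which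
    makes it piecewise continuous whatever [Derive f] is at exceptional times. *)
Definition profit_rate (p q : R -> R) (theta gamma : R) (sp sq : R -> R) (t : R) : R :=
  exp (- theta * t) *
  (gamma * (hazard p q sp sq t * (1 - adoption p q sp sq t)) - (sp t + sq t)).

Lemma exp_opp_bounds (x : R) : 0 <= x -> 0 <= exp (- x) <= 1.
Proof.
  intros Hx; split; [apply Rlt_le, exp_pos|].
  destruct Hx as [Hx|<-]; [|rewrite Ropp_0, exp_0; lra].
  rewrite <- exp_0; apply Rlt_le, exp_increasing; lra.
Qed.

Section Adoption.
Variables (p q : R -> R) (T : R) (sp sq : R -> R).
Hypotheses (hp : influence_rate p) (hq : influence_rate q) (hT : 0 < T).
Hypotheses (hsp : spending_rate T sp) (hsq : spending_rate T sq).

Lemma cum_external_solves : solves_ode T (cum_external p sp) (fun t => p (sp t)).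
Proof.
  apply (primitive_solves_ode T (fun t => p (sp t))); auto.
  apply spending_rate_influence; auto.
Qed.

Lemma cum_external_nonneg t : 0 <= t <= T -> 0 <= cum_external p sp t.
Proof.
  apply primitive_nonneg; auto; [apply spending_rate_influence; auto|].
  intros u Hu; apply hp, hsp; auto.
Qed.

Lemma hazard_piecewise_continuous : piecewise_continuous T (hazard p q sp sq).
Proof.
  apply piecewise_continuous_plus; [apply spending_rate_influence; auto|].
  apply piecewise_continuous_mult; [apply spending_rate_influence; auto|].
  apply continuous_on_piecewise_continuous, continuous_on_one_minus_exp_opp.
  apply cum_external_solves.
Qed.

Lemma hazard_nonneg t : 0 <= t <= T -> 0 <= hazard p q sp sq t.
Proof.
  intros Ht; unfold hazard.
  assert (H1 : 0 <= p (sp t)) by (apply hp, hsp; auto).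
  assert (H2 : 0 <= q (sq t)) by (apply hq, hsq; auto).
  assert (H3 := exp_opp_bounds _ (cum_external_nonneg t Ht)).
  assert (0 <= q (sq t) * (1 - exp (- cum_external p sp t))) by (apply Rmult_le_pos; lra).
  lra.
Qed.

Lemma cum_hazard_solves : solves_ode T (cum_hazard p q sp sq) (hazard p q sp sq).
Proof. apply primitive_solves_ode, hazard_piecewise_continuous; auto. Qed.

Lemma cum_hazard_nonneg t : 0 <= t <= T -> 0 <= cum_hazard p q sp sq t.
Proof.
  apply primitive_nonneg; auto; [apply hazard_piecewise_continuous|apply hazard_nonneg].
Qed.

Lemma adoption_solves :
  solves_ode T (adoption p q sp sq)
    (fun t => hazard p q sp sq t * (1 - adoption p q sp sq t)).
Proof.
  destruct cum_hazard_solves as [Hc Hd]; split.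
  - apply continuous_on_one_minus_exp_opp, Hc.
  - apply (almost_imp 0 T _ _ Hd); intros t _ H; unfold adoption.
    auto_derive; [eexists; apply H|].
    rewrite (Derive_eta _ _ _ H); ring.
Qed.

Lemma cum_hazard_0 : cum_hazard p q sp sq 0 = 0.
Proof. exact (RInt_point 0 (hazard p q sp sq)). Qed.

Lemma adoption_0 : adoption p q sp sq 0 = 0.
Proof. unfold adoption; rewrite cum_hazard_0, Ropp_0, exp_0; ring. Qed.

(** Integrating factor: [(1 - f) * exp (cum_hazard)] has zero derivative off a finite set, so it
    keeps its initial value. *)
Lemma adoption_unique (f : R -> R) :
  solves_ode T f (fun t => hazard p q sp sq t * (1 - f t)) -> f 0 = 0 ->
  forall t, 0 <= t <= T -> f t = adoption p q sp sq t.
Proof.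
  intros [Fc Fd] F0 t Ht; destruct cum_hazard_solves as [Hc Hd].
  assert (H : (1 - f t) * exp (cum_hazard p q sp sq t) =
              (1 - f 0) * exp (cum_hazard p q sp sq 0)).
  { apply (derive_zero_constant T (fun t => (1 - f t) * exp (cum_hazard p q sp sq t))); auto.
    split.
    - apply continuous_on_mult.
      + apply continuous_on_minus; [apply continuous_on_const|auto].
      + apply (continuous_on_comp _ exp); auto; intros x.
        apply (ex_derive_continuous exp); auto_derive; auto.
    - apply (almost_imp 0 T _ _ (almost_and 0 T _ _ Fd Hd)); intros u _ [H1 H2].
      auto_derive; [repeat split; eexists; [apply H1|apply H2]|].
      rewrite (Derive_eta _ _ _ H1), (Derive_eta _ _ _ H2); ring. }
  unfold adoption; rewrite F0, cum_hazard_0, exp_0 in H.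
  rewrite exp_Ropp; assert (E := exp_pos (cum_hazard p q sp sq t)).
  apply Rmult_eq_reg_r with (exp (cum_hazard p q sp sq t)); [|lra].
  field_simplify; lra.
Qed.

Lemma is_profit_of_solution (theta gamma P : R) (f : R -> R) :
  adoption_level p q T sp sq f ->
  is_RInt (fun t => exp (- theta * t) * (gamma * Derive f t - (sp t + sq t))) 0 T P <->
  is_RInt (profit_rate p q theta gamma sp sq) 0 T P.
Proof.
  intros [Hf F0].
  assert (E : almost 0 T (fun t =>
    exp (- theta * t) * (gamma * Derive f t - (sp t + sq t)) =
    profit_rate p q theta gamma sp sq t)).
  { apply (almost_imp 0 T _ _ (proj2 Hf)); intros t Ht H.
    rewrite (is_derive_unique f t _ H).
    unfold profit_rate; rewrite <- (adoption_unique f Hf F0 t) by lra; reflexivity. }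
  split; apply is_RInt_ext_almost; auto.
  apply (almost_imp 0 T _ _ E); auto.
Qed.

Lemma profit_rate_piecewise_continuous (theta gamma : R) :
  piecewise_continuous T (profit_rate p q theta gamma sp sq).
Proof.
  apply piecewise_continuous_mult.
  - apply continuous_on_piecewise_continuous, continuous_on_exp_scal.
  - apply piecewise_continuous_minus; [|apply piecewise_continuous_plus; [apply hsp|apply hsq]].
    apply piecewise_continuous_mult.
    + apply continuous_on_piecewise_continuous, continuous_on_const.
    + apply piecewise_continuous_mult; [apply hazard_piecewise_continuous|].
      apply piecewise_continuous_minus; apply continuous_on_piecewise_continuous.
      * apply continuous_on_const.
      * apply adoption_solves.
Qed.

(** Existence and uniqueness of the adoption level turn the profit relation into a function of the
    promotion, so that optimality becomes an inequality between integrals. *)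
Lemma is_profit_iff (theta gamma P : R) :
  is_profit p q T theta gamma sp sq P <-> P = RInt (profit_rate p q theta gamma sp sq) 0 T.
Proof.
  assert (L : adoption_level p q T sp sq (adoption p q sp sq)).
  { split; [apply adoption_solves|apply adoption_0]. }
  split.
  - intros [f [Hf HP]]; symmetry; apply is_RInt_unique.
    apply (is_profit_of_solution theta gamma P f Hf); auto.
  - intros ->; exists (adoption p q sp sq); split; auto.
    apply (is_profit_of_solution theta gamma _ _ L).
    apply (RInt_correct (V := R_CompleteNormedModule)), piecewise_continuous_ex_RInt; auto.
    apply profit_rate_piecewise_continuous.
Qed.

End Adoption.

(** * Needle variations of a promotion *)

(** Written with sums and products instead of a case distinction, so that closure of piecewise
    continuity under arithmetic applies. *)
Definition needle (t0 t1 : R) (s alpha : R -> R) (t : R) : R :=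
  s t + needle_indicator t0 t1 t * (alpha t - s t).

Lemma needle_indicator_cases (t0 t1 t : R) :
  (t0 < t < t1 /\ needle_indicator t0 t1 t = 1) \/
  (~ t0 < t < t1 /\ needle_indicator t0 t1 t = 0).
Proof. unfold needle_indicator; repeat destruct Rlt_dec; (left + right); split; lra. Qed.

Lemma needle_spending_rate (T t0 t1 : R) (s alpha : R -> R) :
  spending_rate T s -> spending_rate T alpha -> spending_rate T (needle t0 t1 s alpha).
Proof.
  intros [Hs S0] [Ha A0]; split.
  - apply piecewise_continuous_plus; auto; apply piecewise_continuous_mult.
    + assert (L : forall (F : (R -> Prop) -> Prop) c, Filter F ->
        F (fun u => needle_indicator t0 t1 u = c) ->
        filterlim (needle_indicator t0 t1) F (locally c)).
      { intros F c FF H; apply filterlim_ext_loc with (fun _ => c); [|apply filterlim_const].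
        apply filter_imp with (2 := H); auto. }
      split; [|split].
      * apply (almost_imp 0 T _ _ (almost_and 0 T _ _ (almost_neq 0 T t0) (almost_neq 0 T t1))).
        intros t _ [N0 N1]; apply L; [apply locally_filter|].
        destruct (Rlt_dec t t0); [|destruct (Rlt_dec t t1)].
        -- apply (locally_interval _ t m_infty t0); simpl; auto; intros u _ Hu.
           unfold needle_indicator; repeat destruct Rlt_dec; lra.
        -- apply (locally_interval _ t t0 t1); simpl; auto; try lra; intros u Hu Hu'.
           unfold needle_indicator; repeat destruct Rlt_dec; lra.
        -- apply (locally_interval _ t t1 p_infty); simpl; auto; try lra; intros u Hu _.
           unfold needle_indicator; repeat destruct Rlt_dec; lra.
      (* To the right of an end point of the needle that end point is already passed, to its left
         not yet; hence strict tests for the right limits and non-strict ones for the left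
         limits. *)
      * intros t _; destruct (Rlt_dec t t0); [|destruct (Rlt_dec t t1)];
          [exists 0|exists 1|exists 0]; (apply L; [apply within_filter, locally_filter|]).
        -- apply (locally_interval _ t m_infty t0); simpl; auto; intros u _ Hu _.
           unfold needle_indicator; repeat destruct Rlt_dec; lra.
        -- apply (locally_interval _ t m_infty t1); simpl; auto; intros u _ Hu Hu'.
           unfold needle_indicator; repeat destruct Rlt_dec; lra.
        -- exists (mkposreal 1 Rlt_0_1); intros u _ Hu.
           unfold needle_indicator; repeat destruct Rlt_dec; lra.
      * intros t _; destruct (Rle_dec t t0); [|destruct (Rle_dec t t1)];
          [exists 0|exists 1|exists 0]; (apply L; [apply within_filter, locally_filter|]).
        -- exists (mkposreal 1 Rlt_0_1); intros u _ Hu.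
           unfold needle_indicator; repeat destruct Rlt_dec; lra.
        -- apply (locally_interval _ t t0 p_infty); simpl; auto; try lra; intros u Hu _ Hu'.
           unfold needle_indicator; repeat destruct Rlt_dec; lra.
        -- apply (locally_interval _ t t1 p_infty); simpl; auto; try lra; intros u Hu _ Hu'.
           unfold needle_indicator; repeat destruct Rlt_dec; lra.
    + apply piecewise_continuous_minus; auto.
  - intros t Ht; unfold needle.
    assert (H1 := S0 t Ht); assert (H2 := A0 t Ht).
    destruct (needle_indicator_cases t0 t1 t) as [[_ ->]|[_ ->]]; lra.
Qed.

(** * Taylor and remainder estimates *)

Lemma Rabs_mult_le (a b A B : R) : Rabs a <= A -> Rabs b <= B -> Rabs (a * b) <= A * B.
Proof.
  intros Ha Hb; rewrite Rabs_mult.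
  apply Rmult_le_compat; auto; apply Rabs_pos.
Qed.

(** Both bounds follow from [1 + z <= exp z], used at [x - y] and at [y - x]. *)
Lemma exp_opp_taylor (x y : R) : 0 <= x -> 0 <= y ->
  Rabs (exp (- y) - exp (- x)) <= Rabs (y - x) /\
  Rabs (exp (- y) - exp (- x) + exp (- x) * (y - x)) <= Rabs (y - x) * Rabs (y - x).
Proof.
  intros Hx Hy.
  assert (Bx := exp_opp_bounds x Hx); assert (By := exp_opp_bounds y Hy).
  assert (H1 : exp (- x) * (1 + (x - y)) <= exp (- y)).
  { replace (- y) with (- x + (x - y)) by ring; rewrite exp_plus.
    apply Rmult_le_compat_l; [lra|apply exp_ineq1_le]. }
  assert (H2 : exp (- y) * (1 + (y - x)) <= exp (- x)).
  { replace (- x) with (- y + (y - x)) by ring; rewrite exp_plus.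
    apply Rmult_le_compat_l; [lra|apply exp_ineq1_le]. }
  generalize dependent (exp (- x)); generalize dependent (exp (- y)); intros v Hv w Hw H1 H2.
  assert (L : Rabs (v - w) <= Rabs (y - x)).
  { unfold Rabs; repeat destruct Rcase_abs; nra. }
  split; auto.
  (* The lower bound is [H1] and the upper one [H2]: the Taylor error is squeezed between zero and a
     product of two differences, one of which the Lipschitz bound [L] controls. *)
  assert (P : 0 <= v - w + w * (y - x) <= (w - v) * (y - x)) by lra.
  rewrite Rabs_pos_eq by lra.
  apply Rle_trans with (1 := proj2 P), Rle_trans with (1 := Rle_abs _).
  apply Rabs_mult_le; [rewrite Rabs_minus_sym; auto|lra].
Qed.

Lemma Rabs_le_unit (x : R) : 0 <= x <= 1 -> Rabs x <= 1.
Proof. intros; rewrite Rabs_pos_eq; lra. Qed.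

(* [E] is the costate coefficient [gamma e^(-theta t) + psi1]; primes mark the
   perturbed state. *)
Lemma costate_remainder_bound (M C h i E Q dP dQ u u' v v' dy : R) :
  0 <= i <= 1 -> Rabs E <= M -> Rabs Q <= M ->
  Rabs dP <= M * i -> Rabs dQ <= M * i ->
  0 <= u <= 1 -> 0 <= u' <= 1 -> 0 <= v <= 1 -> 0 <= v' <= 1 ->
  Rabs dy <= M * h -> Rabs (v' - v) <= M * h ->
  Rabs (v' - v + v * dy) <= (M * h) * (M * h) -> Rabs (u' - u) <= C * h ->
  Rabs (E * ((dP + dQ * (1 - v')) * (u' - u) - dQ * (v' - v) * u
             - Q * (v' - v + v * dy) * u' + Q * v * dy * (u' - u)))
  <= (M ^ 4 + M ^ 3 * C) * h ^ 2 + (2 * M ^ 2 * C + M ^ 3) * h * i.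
Proof.
  intros Hi HE HQ HP HdQ Hu Hu' Hv Hv' Hdy Hdv Ht Hdu.
  assert (T1 : Rabs ((dP + dQ * (1 - v')) * (u' - u)) <= (M * i + M * i * 1) * (C * h)).
  { apply Rabs_mult_le; auto; eapply Rle_trans; [apply Rabs_triang|].
    apply Rplus_le_compat; auto; apply Rabs_mult_le; auto; apply Rabs_le_unit; lra. }
  assert (T2 : Rabs (dQ * (v' - v) * u) <= (M * i) * (M * h) * 1).
  { apply Rabs_mult_le; [apply Rabs_mult_le|apply Rabs_le_unit]; auto. }
  assert (T3 : Rabs (Q * (v' - v + v * dy) * u') <= M * ((M * h) * (M * h)) * 1).
  { apply Rabs_mult_le; [apply Rabs_mult_le|apply Rabs_le_unit]; auto. }
  assert (T4 : Rabs (Q * v * dy * (u' - u)) <= M * 1 * (M * h) * (C * h)).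
  { repeat apply Rabs_mult_le; auto; apply Rabs_le_unit; lra. }
  eapply Rle_trans; [apply Rabs_mult_le; [apply HE|]|].
  - eapply Rle_trans; [apply Rabs_triang|apply Rplus_le_compat; [|apply T4]].
    eapply Rle_trans; [apply Rabs_triang|rewrite Rabs_Ropp; apply Rplus_le_compat; [|apply T3]].
    eapply Rle_trans; [apply Rabs_triang|rewrite Rabs_Ropp; apply Rplus_le_compat; [apply T1|apply T2]].
  - right; ring.
Qed.

Lemma common_bound (l : list (R -> R)) (D : R -> Prop) :
  (forall g, In g l -> exists M, forall t, D t -> Rabs (g t) <= M) ->
  exists M, 0 <= M /\ forall g, In g l -> forall t, D t -> Rabs (g t) <= M.
Proof.
  induction l as [|g l IH]; intros H.
  - exists 0; split; [lra|intros g []].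
  - destruct (H g (or_introl eq_refl)) as [M1 H1].
    destruct IH as [M2 [P2 H2]]; [intros; apply H; right; auto|].
    exists (Rmax M1 M2); split; [apply Rle_trans with M2; auto; apply Rmax_r|].
    intros k [<-|Hk] t Ht.
    + apply Rle_trans with M1; [auto|apply Rmax_l].
    + apply Rle_trans with M2; [apply (H2 k); auto|apply Rmax_r].
Qed.

(** * First-order effect of a needle on the profit *)

Section NeedleVariation.
Variables (p q : R -> R) (T theta gamma : R) (sp sq alpha beta psi1 psi2 : R -> R).
Hypotheses (hp : influence_rate p) (hq : influence_rate q) (hT : 0 < T).
Hypotheses (hsp : spending_rate T sp) (hsq : spending_rate T sq).
Hypotheses (halpha : spending_rate T alpha) (hbeta : spending_rate T beta).
Hypothesis hpsi1 : solves_ode T psi1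
  (fun t => (gamma * exp (- theta * t) + psi1 t) * hazard p q sp sq t).
Hypothesis hpsi1T : psi1 T = 0.
Hypothesis hpsi2 : solves_ode T psi2
  (fun t => - (gamma * exp (- theta * t) + psi1 t) * (1 - adoption p q sp sq t)
            * q (sq t) * exp (- cum_external p sp t)).
Hypothesis hpsi2T : psi2 T = 0.

Let H t a b := hamiltonian p q theta gamma t (adoption p q sp sq t)
  (cum_external p sp t) (psi1 t) (psi2 t) a b.

(** Both rates lie between [0] and [M], so their difference is at most [M] and not merely
    [2 * M]. *)
Lemma rate_needle_diff (r s a : R -> R) (M t0 t1 t : R) :
  influence_rate r -> spending_rate T s -> spending_rate T a -> 0 <= t <= T ->
  Rabs (r (s t)) <= M -> Rabs (r (a t)) <= M ->
  Rabs (r (needle t0 t1 s a t) - r (s t)) <= M * needle_indicator t0 t1 t.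
Proof.
  intros Hr [_ Hs] [_ Ha] Ht Ms Ma; unfold needle.
  assert (N1 : 0 <= r (s t)) by (apply Hr, Hs; auto).
  assert (N2 : 0 <= r (a t)) by (apply Hr, Ha; auto).
  rewrite Rabs_pos_eq in Ms, Ma by auto.
  destruct (needle_indicator_cases t0 t1 t) as [[_ ->]|[_ ->]].
  - replace (s t + 1 * (a t - s t)) with (a t) by ring; apply Rabs_le; lra.
  - replace (s t + 0 * (a t - s t)) with (s t) by ring.
    rewrite Rminus_diag, Rabs_R0; lra.
Qed.

(** The cumulative hazard is compared instead of [f], because its rate depends on the state through
    [y] alone. On the needle the two rates [p] and [q] change the hazard by at most [2 * M];
    everywhere the shift of [y] adds at most [M] times [M * (t1 - t0)], which integrates to the term
    with [M ^ 2 * T]. *)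
Lemma state_perturbation (M t0 t1 : R) :
  0 <= M ->
  (forall t, 0 <= t <= T -> Rabs (p (sp t)) <= M /\ Rabs (p (alpha t)) <= M /\
     Rabs (q (sq t)) <= M /\ Rabs (q (beta t)) <= M) ->
  0 <= t0 < t1 -> t1 <= T ->
  let sp' := needle t0 t1 sp alpha in
  let sq' := needle t0 t1 sq beta in
  forall t, 0 <= t <= T ->
    Rabs (cum_external p sp' t - cum_external p sp t) <= M * (t1 - t0) /\
    Rabs (cum_hazard p q sp' sq' t - cum_hazard p q sp sq t)
      <= (M ^ 2 * T + 2 * M) * (t1 - t0).
Proof.
  intros HM Mb H01 H1T sp' sq'.
  assert (hsp' : spending_rate T sp') by (apply needle_spending_rate; auto).
  assert (hsq' : spending_rate T sq') by (apply needle_spending_rate; auto).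
  assert (Dy : forall t, 0 <= t <= T ->
    Rabs (cum_external p sp' t - cum_external p sp t) <= M * (t1 - t0)).
  { destruct (cum_external_solves p T sp hp hT hsp) as [C1 D1].
    destruct (cum_external_solves p T sp' hp hT hsp') as [C2 D2].
    intros t Ht; replace (M * (t1 - t0)) with (0 * T + M * (t1 - t0)) by ring.
    apply (needle_growth_abs T t0 t1 0 M t
      (fun t => cum_external p sp' t - cum_external p sp t)
      (fun t => p (sp' t) - p (sp t))); auto; try lra.
    - apply continuous_on_minus; auto.
    - unfold cum_external; rewrite !RInt_point; apply Rminus_diag.
    - apply (almost_imp 0 T _ _ (almost_and 0 T _ _ D2 D1)); intros u Hu [E2 E1]; split.
      + apply (is_derive_minus (cum_external p sp') (cum_external p sp) u _ _ E2 E1).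
      + rewrite Rplus_0_l; apply rate_needle_diff; auto; try apply Mb; lra. }
  intros t Ht; split; auto.
  destruct (cum_hazard_solves p q T sp sq hp hq hT hsp hsq) as [C1 D1].
  destruct (cum_hazard_solves p q T sp' sq' hp hq hT hsp' hsq') as [C2 D2].
  replace ((M ^ 2 * T + 2 * M) * (t1 - t0))
    with (M * (M * (t1 - t0)) * T + 2 * M * (t1 - t0)) by ring.
  assert (Hh : 0 <= M * (t1 - t0)) by (apply Rmult_le_pos; lra).
  apply (needle_growth_abs T t0 t1 (M * (M * (t1 - t0))) (2 * M) t
    (fun t => cum_hazard p q sp' sq' t - cum_hazard p q sp sq t)
    (fun t => hazard p q sp' sq' t - hazard p q sp sq t)); auto; try lra.
  - apply Rmult_le_pos; auto.
  - apply continuous_on_minus; auto.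
  - rewrite !cum_hazard_0; ring.
  - apply (almost_imp 0 T _ _ (almost_and 0 T _ _ D2 D1)); intros u Hu [E2 E1]; split.
    + apply (is_derive_minus (cum_hazard p q sp' sq') (cum_hazard p q sp sq) u _ _ E2 E1).
    + assert (Hu' : 0 <= u <= T) by lra.
      destruct (Mb u Hu') as [B1 [B2 [B3 B4]]].
      assert (Y1 := cum_external_nonneg p T sp hp hT hsp u Hu').
      assert (Y2 := cum_external_nonneg p T sp' hp hT hsp' u Hu').
      destruct (exp_opp_taylor _ _ Y1 Y2) as [Dv _].
      assert (V2 := exp_opp_bounds _ Y2).
      assert (K1 := rate_needle_diff p sp alpha M t0 t1 u hp hsp halpha Hu' B1 B2).
      assert (K2 := rate_needle_diff q sq beta M t0 t1 u hq hsq hbeta Hu' B3 B4).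
      fold sp' in K1; fold sq' in K2; assert (K3 := Dy u Hu').
      unfold hazard.
      (* One factor is changed at a time: the change of [q] meets the new [1 - exp (- y)], which
         lies in [0,1], and the change of [exp (- y)] meets the old rate [q (sq u)], at most [M]. *)
      replace (p (sp' u) + q (sq' u) * (1 - exp (- cum_external p sp' u)) -
        (p (sp u) + q (sq u) * (1 - exp (- cum_external p sp u))))
        with ((p (sp' u) - p (sp u))
              + (q (sq' u) - q (sq u)) * (1 - exp (- cum_external p sp' u))
              + q (sq u) * - (exp (- cum_external p sp' u) - exp (- cum_external p sp u)))
        by ring.
      replace (M * (M * (t1 - t0)) + 2 * M * needle_indicator t0 t1 u)
        with (M * needle_indicator t0 t1 u + M * needle_indicator t0 t1 u * 1
              + M * (M * (t1 - t0))) by ring.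
      repeat (eapply Rle_trans; [apply Rabs_triang|apply Rplus_le_compat]);
        [exact K1|apply Rabs_mult_le; [exact K2|apply Rabs_le_unit; lra]
        |apply Rabs_mult_le; [exact B3|rewrite Rabs_Ropp; lra]].
Qed.

(* The costates cancel the first-order effect of the perturbed state on the
   profit; only the change of the Hamiltonian on the needle is of order
   [t1 - t0]. *)
Lemma needle_profit_gain :
  exists C, forall t0 t1 m, 0 <= t0 < t1 -> t1 <= T ->
    (forall t, t0 < t < t1 -> m <= H t (alpha t) (beta t) - H t (sp t) (sq t)) ->
    m * (t1 - t0) - C * (t1 - t0) ^ 2 <=
    RInt (profit_rate p q theta gamma (needle t0 t1 sp alpha) (needle t0 t1 sq beta)) 0 T
    - RInt (profit_rate p q theta gamma sp sq) 0 T.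
Proof.
  destruct (common_bound
    ((fun t => p (sp t)) :: (fun t => p (alpha t)) :: (fun t => q (sq t))
     :: (fun t => q (beta t)) :: (fun t => gamma * exp (- theta * t) + psi1 t) :: nil)
    (fun t => 0 <= t <= T)) as [M [HM HB]].
  { intros g Hg; apply piecewise_continuous_bounded; auto.
    destruct Hg as [<-|[<-|[<-|[<-|[<-|[]]]]]]; try solve [apply spending_rate_influence; auto].
    apply continuous_on_piecewise_continuous, continuous_on_plus; [|apply hpsi1].
    apply continuous_on_mult; [apply continuous_on_const|apply continuous_on_exp_scal]. }
  assert (Mb : forall t, 0 <= t <= T -> Rabs (p (sp t)) <= M /\ Rabs (p (alpha t)) <= M /\
     Rabs (q (sq t)) <= M /\ Rabs (q (beta t)) <= M).
  { intros t Ht; repeat split;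
      [apply (HB (fun t => p (sp t)))|apply (HB (fun t => p (alpha t)))
      |apply (HB (fun t => q (sq t)))|apply (HB (fun t => q (beta t)))];
      simpl; auto 10. }
  assert (ME : forall t, 0 <= t <= T -> Rabs (gamma * exp (- theta * t) + psi1 t) <= M).
  { apply (HB (fun t => gamma * exp (- theta * t) + psi1 t)); simpl; auto 10. }
  clear HB; set (C := M ^ 2 * T + 2 * M).
  (* In [costate_remainder_bound] the term with [h ^ 2] acts on all of [0,T], the term with [h] only
     on the needle, of length [h]. Integrated, both give a multiple of [h ^ 2]. *)
  exists ((M ^ 4 + M ^ 3 * C) * T + (2 * M ^ 2 * C + M ^ 3)).
  intros t0 t1 m H01 H1T Hm.
  assert (DS := state_perturbation M t0 t1 HM Mb H01 H1T); simpl in DS.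
  set (sp' := needle t0 t1 sp alpha) in *; set (sq' := needle t0 t1 sq beta) in *.
  assert (hsp' : spending_rate T sp') by (apply needle_spending_rate; auto).
  assert (hsq' : spending_rate T sq') by (apply needle_spending_rate; auto).
  set (h := t1 - t0) in *.
  set (J1 := fun t => RInt (profit_rate p q theta gamma sp sq) 0 t).
  set (J2 := fun t => RInt (profit_rate p q theta gamma sp' sq') 0 t).
  set (f1 := adoption p q sp sq); set (f2 := adoption p q sp' sq').
  set (y1 := cum_external p sp); set (y2 := cum_external p sp').
  destruct (primitive_solves_ode T _ hT
    (profit_rate_piecewise_continuous p q T sp sq hp hq hT hsp hsq theta gamma)) as [CJ1 DJ1].
  destruct (primitive_solves_ode T _ hT
    (profit_rate_piecewise_continuous p q T sp' sq' hp hq hT hsp' hsq' theta gamma)) as [CJ2 DJ2].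
  destruct (adoption_solves p q T sp sq hp hq hT hsp hsq) as [Cf1 Df1].
  destruct (adoption_solves p q T sp' sq' hp hq hT hsp' hsq') as [Cf2 Df2].
  destruct (cum_external_solves p T sp hp hT hsp) as [Cy1 Dy1].
  destruct (cum_external_solves p T sp' hp hT hsp') as [Cy2 Dy2].
  destruct hpsi1 as [Cp1 Dp1]; destruct hpsi2 as [Cp2 Dp2].
  (* At time [0] the two states agree and at time [T] the costates vanish, so the increment of [Z]
     is exactly the profit gain. *)
  set (Z := fun t => J2 t - J1 t + (psi1 t * (f2 t - f1 t) + psi2 t * (y2 t - y1 t))).
  assert (Z0 : Z 0 = 0).
  { unfold Z, J1, J2, f1, f2, y1, y2, cum_external; rewrite !adoption_0, !RInt_point.
    change zero with 0; ring. }
  assert (ZT : Z T = J2 T - J1 T) by (unfold Z; rewrite hpsi1T, hpsi2T; ring).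
  change (m * h - ((M ^ 4 + M ^ 3 * C) * T + (2 * M ^ 2 * C + M ^ 3)) * h ^ 2 <= J2 T - J1 T).
  rewrite <- ZT; replace (Z T) with (Z T - Z 0) by (rewrite Z0; ring).
  (* The bound takes the form of [needle_growth_ge] at time [T], when the whole needle has been
     passed. *)
  replace (m * h - ((M ^ 4 + M ^ 3 * C) * T + (2 * M ^ 2 * C + M ^ 3)) * h ^ 2)
    with (- ((M ^ 4 + M ^ 3 * C) * h ^ 2) * T
          + (m - (2 * M ^ 2 * C + M ^ 3) * h) * (Rmin T t1 - Rmin T t0))
    by (rewrite !Rmin_right by lra; unfold h; ring).
  set (E := fun t => gamma * exp (- theta * t) + psi1 t).
  set (dZ := fun t => profit_rate p q theta gamma sp' sq' t
    - profit_rate p q theta gamma sp sq t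
    + (E t * hazard p q sp sq t * (f2 t - f1 t)
       + psi1 t * (hazard p q sp' sq' t * (1 - f2 t) - hazard p q sp sq t * (1 - f1 t))
       + (- E t * (1 - f1 t) * q (sq t) * exp (- y1 t) * (y2 t - y1 t)
          + psi2 t * (p (sp' t) - p (sp t))))).
  apply (needle_growth_ge T t0 t1 (- ((M ^ 4 + M ^ 3 * C) * h ^ 2))
    (m - (2 * M ^ 2 * C + M ^ 3) * h) T Z dZ); auto; try lra.
  { exact (continuous_on_plus _ _ _ (continuous_on_minus _ _ _ CJ2 CJ1)
      (continuous_on_plus _ _ _
        (continuous_on_mult _ _ _ Cp1 (continuous_on_minus _ _ _ Cf2 Cf1))
        (continuous_on_mult _ _ _ Cp2 (continuous_on_minus _ _ _ Cy2 Cy1)))). }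
  assert (DA := almost_and 0 T _ _ (almost_and 0 T _ _ (almost_and 0 T _ _ DJ1 DJ2)
    (almost_and 0 T _ _ Df1 Df2))
    (almost_and 0 T _ _ (almost_and 0 T _ _ Dy1 Dy2) (almost_and 0 T _ _ Dp1 Dp2))).
  apply (almost_imp 0 T _ _ DA); clear DA;
    intros t Ht [[[EJ1 EJ2] [Ef1 Ef2]] [[Ey1 Ey2] [Ep1 Ep2]]]; split.
  - unfold Z; auto_derive.
    + exact (conj (ex_intro _ _ EJ2) (conj (ex_intro _ _ EJ1) (conj (ex_intro _ _ Ep1)
        (conj (ex_intro _ _ Ef2) (conj (ex_intro _ _ Ef1) (conj (ex_intro _ _ Ep2)
        (conj (ex_intro _ _ Ey2) (conj (ex_intro _ _ Ey1) I)))))))).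
    + rewrite (Derive_eta J1 _ _ EJ1), (Derive_eta J2 _ _ EJ2), (Derive_eta f1 _ _ Ef1),
        (Derive_eta f2 _ _ Ef2), (Derive_eta y1 _ _ Ey1), (Derive_eta y2 _ _ Ey2),
        (Derive_eta psi1 _ _ Ep1), (Derive_eta psi2 _ _ Ep2).
      unfold dZ, E, f1, f2, y1; ring.
  - assert (Ht' : 0 <= t <= T) by lra.
    destruct (Mb t Ht') as [B1 [B2 [B3 B4]]].
    destruct (DS t Ht') as [S1 S2].
    assert (Y1 := cum_external_nonneg p T sp hp hT hsp t Ht').
    assert (Y2 := cum_external_nonneg p T sp' hp hT hsp' t Ht').
    assert (W1 := cum_hazard_nonneg p q T sp sq hp hq hT hsp hsq t Ht').
    assert (W2 := cum_hazard_nonneg p q T sp' sq' hp hq hT hsp' hsq' t Ht').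
    destruct (exp_opp_taylor _ _ Y1 Y2) as [Dv Tv].
    destruct (exp_opp_taylor _ _ W1 W2) as [Du _].
    assert (I : 0 <= needle_indicator t0 t1 t <= 1).
    { destruct (needle_indicator_cases t0 t1 t) as [[_ ->]|[_ ->]]; lra. }
    assert (Rb := costate_remainder_bound M C h (needle_indicator t0 t1 t) (E t) (q (sq t))
      (p (sp' t) - p (sp t)) (q (sq' t) - q (sq t))
      (exp (- cum_hazard p q sp sq t)) (exp (- cum_hazard p q sp' sq' t))
      (exp (- y1 t)) (exp (- y2 t)) (y2 t - y1 t) I (ME t Ht') B3
      (rate_needle_diff p sp alpha M t0 t1 t hp hsp halpha Ht' B1 B2)
      (rate_needle_diff q sq beta M t0 t1 t hq hsq hbeta Ht' B3 B4)
      (exp_opp_bounds _ W1) (exp_opp_bounds _ W2) (exp_opp_bounds _ Y1) (exp_opp_bounds _ Y2)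
      S1 (Rle_trans _ _ _ Dv S1)
      (Rle_trans _ _ _ Tv (Rmult_le_compat _ _ _ _ (Rabs_pos _) (Rabs_pos _) S1 S1))
      (Rle_trans _ _ _ Du S2)).
    assert (HH : m * needle_indicator t0 t1 t <= H t (sp' t) (sq' t) - H t (sp t) (sq t)).
    { unfold sp', sq', needle.
      destruct (needle_indicator_cases t0 t1 t) as [[Hi ->]|[_ ->]].
      - replace (sp t + 1 * (alpha t - sp t)) with (alpha t) by ring.
        replace (sq t + 1 * (beta t - sq t)) with (beta t) by ring.
        rewrite Rmult_1_r; auto.
      - replace (sp t + 0 * (alpha t - sp t)) with (sp t) by ring.
        replace (sq t + 0 * (beta t - sq t)) with (sq t) by ring; lra. }
    apply Rabs_le_between, proj1 in Rb.
    (* An exact identity. The equation of [psi1] removes the term in the change of [f] times the old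
       hazard, and that of [psi2] removes the linear part of the change of [exp (- y)]; what remains
       beyond the change of [H] is the quantity bounded in [Rb]. *)
    match type of Rb with _ <= ?r =>
      replace (dZ t) with (H t (sp' t) (sq' t) - H t (sp t) (sq t) + r)
        by (unfold dZ, E, H, hamiltonian, df_dt, profit_rate, f1, f2, y1, y2,
              adoption, hazard; ring) end.
    lra.
Qed.

Hypothesis hmax : forall sp' sq', spending_rate T sp' -> spending_rate T sq' ->
  RInt (profit_rate p q theta gamma sp' sq') 0 T <= RInt (profit_rate p q theta gamma sp sq) 0 T.

(** If the Hamiltonian gain [D t] were positive, continuity would keep it above [D t / 2] near [t],
    and a short needle there would raise the profit by at least [h * (D t / 2 - C * h) > 0]. *)
Lemma needle_maximum (t : R) :
  0 <= t <= T ->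
  continuous_at_in T (fun u => H u (alpha u) (beta u) - H u (sp u) (sq u)) t ->
  H t (alpha t) (beta t) <= H t (sp t) (sq t).
Proof.
  intros Ht Hc; apply Rnot_lt_le; intros Hlt.
  set (D := fun u => H u (alpha u) (beta u) - H u (sp u) (sq u)) in Hc.
  assert (m_pos : 0 < D t / 2) by (unfold D; lra).
  destruct (Hc _ (locally_ball (D t) (mkposreal _ m_pos))) as [d Hd].
  destruct needle_profit_gain as [C HC].
  assert (C_pos : 0 < Rabs C + 1) by (generalize (Rabs_pos C); lra).
  (* The bound [d / 2] keeps the needle where [D] is large, [T / 2] lets it fit on one side of [t],
     and the last bound gives [C * h <= D t / 4]. The divisor [Rabs C + 1] is positive whatever the
     sign of [C]. *)
  set (h := Rmin (Rmin (d / 2) (T / 2)) (D t / 2 / (Rabs C + 1) / 2)).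
  assert (Hh : 0 < h /\ h <= d / 2 /\ h <= T / 2 /\ h <= D t / 2 / (Rabs C + 1) / 2).
  { assert (0 < d / 2) by (apply Rdiv_lt_0_compat; [apply cond_pos|lra]).
    assert (0 < D t / 2 / (Rabs C + 1)) by (apply Rdiv_lt_0_compat; lra).
    unfold h; split; [repeat apply Rmin_glb_lt; lra|].
    repeat split; [eapply Rle_trans; [apply Rmin_l|apply Rmin_l]
      |eapply Rle_trans; [apply Rmin_l|apply Rmin_r]|apply Rmin_r]. }
  clearbody h; destruct Hh as [h_pos [hd [hT2 hC]]].
  assert (Hm : forall u, 0 <= u <= T -> Rabs (u - t) < d -> D t / 2 <= D u).
  { intros u Hu Hut; assert (B := Hd u Hut Hu).
    change (Rabs (D u - D t) < D t / 2) in B; apply Rabs_lt_between in B; lra. }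
  (* The needle begins at [t], or ends there if too little time is left; this includes both ends of
     the planning horizon. *)
  assert (Hn : exists t0, 0 <= t0 /\ t0 + h <= T /\ t - h <= t0 <= t).
  { destruct (Rle_dec (t + h) T); [exists t|exists (t - h)]; lra. }
  destruct Hn as [t0 [A1 [A2 A3]]].
  assert (G := HC t0 (t0 + h) (D t / 2) ltac:(lra) A2
    ltac:(intros u Hu; apply Hm; [lra|apply Rabs_lt_between; lra])).
  assert (G' := hmax _ _ (needle_spending_rate T t0 (t0 + h) sp alpha hsp halpha)
    (needle_spending_rate T t0 (t0 + h) sq beta hsq hbeta)).
  assert (K : (Rabs C + 1) * h <= D t / 2 / 2).
  { apply Rmult_le_compat_l with (r := Rabs C + 1) in hC; [|lra].
    replace ((Rabs C + 1) * (D t / 2 / (Rabs C + 1) / 2)) with (D t / 2 / 2) in hC by (field; lra).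
    auto. }
  assert (K2 : C * h <= (Rabs C + 1) * h).
  { apply Rmult_le_compat_r; [lra|generalize (Rle_abs C); lra]. }
  replace (t0 + h - t0) with h in G by ring.
  assert (0 < h * (D t / 2 - C * h)) by (apply Rmult_lt_0_compat; lra).
  lra.
Qed.

End NeedleVariation.

(** * From maximality of the Hamiltonian to the critical point condition *)

Lemma constant_spending_rate (T a : R) : 0 <= a -> spending_rate T (fun _ => a).
Proof.
  intros Ha; split; auto.
  apply continuous_on_piecewise_continuous, continuous_on_const.
Qed.

Lemma is_derive_interior_max (G : R -> R) (c : R) :
  0 < c -> ex_derive G c -> (forall a, 0 <= a -> G a <= G c) -> is_derive G c 0.
Proof.
  intros Hc Hd Hm; apply is_derive_Reals.
  set (pr := ex_derive_Reals_0 _ _ Hd).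
  rewrite <- (deriv_maximum G 0 (c + 1) c pr); [|lra|lra|intros; apply Hm; lra].
  apply derive_pt_eq_1 with pr; reflexivity.
Qed.

Lemma influence_rate_continuous_at_in (T t : R) (r s : R -> R) :
  influence_rate r -> spending_rate T s -> 0 <= t <= T ->
  continuous_at_in T s t -> continuous_at_in T (fun u => r (s u)) t.
Proof.
  intros Hr [_ H0] Ht Hs.
  apply (filterlim_rate_comp r s (s t)); auto; [apply within_filter, locally_filter|].
  exists (mkposreal 1 Rlt_0_1); intros u _ Hu; apply H0; auto.
Qed.

(** At zero spending a maximum over nonnegative values need not be critical, and changing a
    promotion at a single time leaves the profit unchanged; hence positivity and continuity at [t]
    in each condition. *)
Theorem theorem6 (p q : R -> R) (T theta gamma : R)
  (sp sq f y psi1 psi2 : R -> R)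
  (hp : influence_rate p) (hq : influence_rate q) (hT : 0 < T)
  (hf : solves_ode T f (fun t => df_dt p q (f t) (y t) (sp t) (sq t)))
  (hf0 : f 0 = 0)
  (hy : solves_ode T y (fun t => p (sp t)))
  (hy0 : y 0 = 0)
  (hpsi1 : solves_ode T psi1
     (fun t => (gamma * exp (- theta * t) + psi1 t)
               * (p (sp t) + q (sq t) * (1 - exp (- y t)))))
  (hpsi1T : psi1 T = 0)
  (hpsi2 : solves_ode T psi2
     (fun t => - (gamma * exp (- theta * t) + psi1 t) * (1 - f t)
               * q (sq t) * exp (- y t)))
  (hpsi2T : psi2 T = 0)
  (hopt : optimal_promotion p q T theta gamma sp sq) :
  forall t, 0 <= t <= T ->
    (continuous_at_in T sp t -> 0 < sp t ->
       is_derive (fun a => hamiltonian p q theta gamma t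
                    (f t) (y t) (psi1 t) (psi2 t) a (sq t)) (sp t) 0) /\
    (continuous_at_in T sq t -> 0 < sq t ->
       is_derive (fun b => hamiltonian p q theta gamma t
                    (f t) (y t) (psi1 t) (psi2 t) (sp t) b) (sq t) 0).
Proof.
  destruct hopt as [hsp [hsq [P [HP Hmax]]]].
  assert (Ey : forall t, 0 <= t <= T -> y t = cum_external p sp t).
  { apply (solves_ode_quadrature_unique T y (cum_external p sp) (fun t => p (sp t))); auto.
    - apply cum_external_solves; auto.
    - rewrite hy0; unfold cum_external; rewrite RInt_point; reflexivity. }
  assert (Ef : forall t, 0 <= t <= T -> f t = adoption p q sp sq t).
  { apply adoption_unique; auto; apply solves_ode_ext with (2 := hf).
    intros t Ht; unfold df_dt, hazard; rewrite Ey by lra; ring. }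
  assert (H1 : solves_ode T psi1
    (fun t => (gamma * exp (- theta * t) + psi1 t) * hazard p q sp sq t)).
  { apply solves_ode_ext with (2 := hpsi1); intros t Ht; rewrite Ey by lra; reflexivity. }
  assert (H2 : solves_ode T psi2 (fun t => - (gamma * exp (- theta * t) + psi1 t)
    * (1 - adoption p q sp sq t) * q (sq t) * exp (- cum_external p sp t))).
  { apply solves_ode_ext with (2 := hpsi2); intros t Ht; rewrite Ey, Ef by lra; reflexivity. }
  assert (Hmax' : forall sp' sq', spending_rate T sp' -> spending_rate T sq' ->
    RInt (profit_rate p q theta gamma sp' sq') 0 T
    <= RInt (profit_rate p q theta gamma sp sq) 0 T).
  { intros sp' sq' Hsp' Hsq'.
    rewrite <- (proj1 (is_profit_iff p q T sp sq hp hq hT hsp hsq theta gamma P) HP).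
    apply (Hmax sp' sq'); auto; apply is_profit_iff; auto. }
  intros t Ht; rewrite (Ef t Ht), (Ey t Ht).
  assert (CE := continuous_on_exp_scal (fun u => 0 <= u <= T) (- theta)).
  assert (Cc := continuous_on_const (fun u => 0 <= u <= T)).
  assert (Cu := continuous_on_minus _ _ _ (Cc 1)
    (proj1 (adoption_solves p q T sp sq hp hq hT hsp hsq))).
  assert (Cv := continuous_on_one_minus_exp_opp _ _ (proj1 (cum_external_solves p T sp hp hT hsp))).
  assert (CEu := continuous_on_mult _ _ _ (continuous_on_plus _ _ _
    (continuous_on_mult _ _ _ (Cc gamma) CE) (proj1 H1)) Cu).
  split; intros Hc Hs; apply is_derive_interior_max; auto.
  - assert (ex_derive p (sp t)) by (apply hp; auto).
    unfold hamiltonian, df_dt; auto_derive; auto.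
  - intros a Ha.
    (* Only the first control is varied, to the constant level [a]; the needle in the second control
       replaces [sq] by itself. *)
    apply (needle_maximum p q T theta gamma sp sq (fun _ => a) sq psi1 psi2); auto.
    { apply constant_spending_rate; auto. }
    assert (Cp := influence_rate_continuous_at_in T t p sp hp hsp Ht Hc).
    assert (FF : Filter (within (fun u => 0 <= u <= T) (locally t))).
    { apply within_filter, locally_filter. }
    (* The terms with [q (sq u)] are equal in the two Hamiltonians and cancel, so a jump of [sq] at
       [t] does no harm; in the other condition the terms with [p (sp u)] cancel likewise. *)
    assert (K := filterlim_Rminus _ _ _ _ _
      (filterlim_Rmult _ _ _ _ _ (continuous_on_plus _ _ _ CEu (proj1 H2) t Ht)
        (filterlim_Rminus _ _ _ _ _ (Cc (p a) t Ht) Cp))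
      (filterlim_Rmult _ _ _ _ _ (CE t Ht) (filterlim_Rminus _ _ _ _ _ (Cc a t Ht) Hc))).
    unfold continuous_at_in.
    match type of K with filterlim _ _ (locally ?x) =>
      match goal with |- filterlim _ _ (locally ?x') => replace x' with x end end.
    + apply filterlim_ext with (2 := K); intros u; unfold hamiltonian, df_dt; ring.
    + unfold hamiltonian, df_dt; ring.
  - assert (ex_derive q (sq t)) by (apply hq; auto).
    unfold hamiltonian, df_dt; auto_derive; auto.
  - intros b Hb.
    apply (needle_maximum p q T theta gamma sp sq sp (fun _ => b) psi1 psi2); auto.
    { apply constant_spending_rate; auto. }
    assert (Cq := influence_rate_continuous_at_in T t q sq hq hsq Ht Hc).
    assert (FF : Filter (within (fun u => 0 <= u <= T) (locally t))).
    { apply within_filter, locally_filter. }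
    assert (K := filterlim_Rminus _ _ _ _ _
      (filterlim_Rmult _ _ _ _ _ (continuous_on_mult _ _ _ CEu Cv t Ht)
        (filterlim_Rminus _ _ _ _ _ (Cc (q b) t Ht) Cq))
      (filterlim_Rmult _ _ _ _ _ (CE t Ht) (filterlim_Rminus _ _ _ _ _ (Cc b t Ht) Hc))).
    unfold continuous_at_in.
    match type of K with filterlim _ _ (locally ?x) =>
      match goal with |- filterlim _ _ (locally ?x') => replace x' with x end end.
    + apply filterlim_ext with (2 := K); intros u; unfold hamiltonian, df_dt; ring.
    + unfold hamiltonian, df_dt; ring.
Qed.
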